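(* Let $q$ be a prime power and $f(x)$ a polynomial over $\mathbb{F}_q$. Then $f(x)$ is a permutation polynomial of $\mathbb{F}_q$ if and only if there exist a positive integer $t$, nonempty finite subsets $S_i$ ($i=1,\ldots,t$) of $\mathbb{F}_q$, maps $\psi_i:\mathbb{F}_q\to S_i$ and $\varphi_i:\mathbb{F}_q\to S_i$ ($i=1,\ldots,t$), and a polynomial $F(x_1,\ldots,x_t)\in\mathbb{F}_q[x_1,\ldots,x_t]$ such that $\psi_i\circ f=\varphi_i$ for $i=1,\ldots,t$ and $x=F(\varphi_1(x),\ldots,\varphi_t(x))$. Moreover, for any such data, $$f^{-1}(x)=F(\psi_1(x),\ldots,\psi_t(x)).$$
   Context: $\mathbb{F}_q$ is the finite field with $q$ elements. A polynomial $f\in\mathbb{F}_q[x]$ is a permutation polynomial of $\mathbb{F}_q$ if it induces a bijection $\mathbb{F}_q\to\mathbb{F}_q$. Maps $\mathbb{F}_q\to\mathbb{F}_q$ are identified with elements of $\mathbb{F}_q[x]/(x^q-x)$, and all identities between polynomials are understood modulo $x^q-x$, i.e. as equalities of functions on $\mathbb{F}_q$. The compositional inverse $f^{-1}(x)$ of a permutation polynomial $f$ is the element of $\mathbb{F}_q[x]/(x^q-x)$ inducing the inverse map. *)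

(* Defs.v *)
From mathcomp Require Export all_boot all_algebra mpoly.

Set Implicit Arguments.
Unset Strict Implicit.
Unset Printing Implicit Defensive.

Import GRing.Theory.
Local Open Scope ring_scope.

Definition perm_poly (K : finFieldType) (f : {poly K}) : Prop :=
  bijective (horner f).

(* Elements of K[x]/(x^q - x), q = #|K|, are identified with the maps K -> K
   they induce, so the compositional inverse is given as a map. *)
Definition comp_inv (K : finFieldType) (f : {poly K}) (fP : perm_poly f) :
  K -> K := invF (bij_inj fP).

(* A map K -> S_i is a map K -> K all of whose values lie in S_i. *)
Definition inversion_data (K : finFieldType) (f : {poly K}) (t : nat)
    (S : 'I_t -> {set K}) (psi phi : 'I_t -> K -> K) (F : {mpoly K[t]}) :
  Prop :=
  [/\ (0 < t)%N,
      forall i, S i != set0,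
      forall i x, (psi i x \in S i) /\ (phi i x \in S i),
      forall i x, psi i f.[x] = phi i x
    & forall x, x = F.@[fun i => phi i x]].

(* Main.v *)
Require Import Defs.

Set Implicit Arguments.
Unset Strict Implicit.
Unset Printing Implicit Defensive.

Local Open Scope ring_scope.

(** The two identities psi_i (f x) = phi_i x and x = F (phi_1 x, ..., phi_t x)
    combine into x = F (psi_1 (f x), ..., psi_t (f x)): the map
    g = F (psi_1, ..., psi_t) is a left inverse of f (lemma
    [inversion_data_cancel]).  On a finite set a map with a left inverse is
    bijective, and that left inverse is its inverse; this gives both the
    sufficiency of the criterion and the formula for the compositional inverse.
    Conversely, a permutation f satisfies the criterion with t = 1, psi_1 the
    inverse of f, phi_1 the identity and F = x_1. *)

Lemma inversion_data_cancel (K : finFieldType) (f : {poly K}) (t : nat)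
    (S : 'I_t -> {set K}) (psi phi : 'I_t -> K -> K) (F : {mpoly K[t]}) :
  inversion_data f S psi phi F ->
  cancel (horner f) (fun y => F.@[fun i => psi i y]).
Proof.
move=> [_ _ _ psi_f F_phi] x.
by rewrite [RHS]F_phi; apply: meval_eq => i; exact: psi_f.
Qed.

Lemma perm_poly_inversion_data (K : finFieldType) (f : {poly K})
    (fP : perm_poly f) :
  inversion_data f (fun _ : 'I_1 => [set: K]) (fun=> comp_inv fP)
    (fun=> id) 'X_ord0.
Proof.
split=> //.
- by move=> _; apply/set0Pn; exists 0; rewrite inE.
- by move=> _ x; exact: (invF_f (bij_inj fP) x).
- by move=> x; rewrite mevalXU.
Qed.

Theorem theorem2p2 (K : finFieldType) (f : {poly K}) :
  (perm_poly f <->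
     exists (t : nat) (S : 'I_t -> {set K}) (psi phi : 'I_t -> K -> K)
            (F : {mpoly K[t]}), inversion_data f S psi phi F)
  /\ (forall (t : nat) (S : 'I_t -> {set K}) (psi phi : 'I_t -> K -> K)
             (F : {mpoly K[t]}), inversion_data f S psi phi F ->
      forall (fP : perm_poly f) (x : K),
        comp_inv fP x = F.@[fun i => psi i x]).
Proof.
split; first split.
- by move=> fP; do 5 eexists; exact: (perm_poly_inversion_data fP).
- move=> [t [S [psi [phi [F /inversion_data_cancel fK]]]]].
  exact: injF_bij (can_inj fK).
- move=> t S psi phi F /inversion_data_cancel fK fP x.
  by rewrite -{2}(f_invF (bij_inj fP) x) fK.
Qed.
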